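(* Let $G$ be a finitely generated abelian group, $\psi:G\to G$ an injective, non-surjective homomorphism, $G*_{\psi}$ the associated ascending HNN-extension, and $\mathcal{A}$ a finite alphabet. Suppose there exist $x\in\mathcal{A}^{G*_{\psi}}$, a subgroup $H\leqslant G$ with $\psi(H)\leqslant H$, and $\ell\ge0$ such that $\psi^{\ell}(H)\leqslant\mathrm{Stab}(x)$. Then all $G$-sections of $x$ of level greater than or equal to $\ell$ are $H$-periodic. Moreover, in the case $H=G$, $x$ assigns the same symbol to all $G$-sections of the same level sharing a common $G$-section of level greater than or equal to $\ell$; that is, whenever two $G$-sections $\Gamma_h,\Gamma_{h'}$ of the same level share a common $G$-section of some level $\geq\ell$, $x$ is constant on $\Gamma_h\cup\Gamma_{h'}$.
   Context: If $G=\langle S\mid R\rangle$ and $\psi:G\to G$ is a monomorphism, the ascending HNN-extension is $G*_{\psi}=\langle S\cup\{t\}\mid R\cup\{tgt^{-1}=\psi(g): g\in G\}\rangle$; $G$ is regarded as a subgroup of $G*_\psi$, and $\psi^{\ell}$ is the $\ell$-fold composition of $\psi$. The shift action on $\mathcal{A}^{G*_\psi}$ is $\sigma_g(x)_h=x_{g^{-1}h}$, and $\mathrm{Stab}(x)=\{g:\sigma_g(x)=x\}$. For $h\in G*_{\psi}$, the $G$-section containing $h$ is $\Gamma_h=\{hg: g\in G\}$. Every $h\in G*_\psi$ is written uniquely as $h=t^{-j}gt^{i}$ with $i,j\ge0$, $g\in G$, where $g\in\psi(G)$ is allowed only if $i=0$ or $j=0$; the level of $\Gamma_h$ is $i-j$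 (this is well defined). For $H\leqslant G$ and $x\in\mathcal{A}^{G*_\psi}$, the $G$-section $\Gamma_h$ of $x$ is $H$-periodic if $x_{hgg'}=x_{hg}$ for all $g\in G$, $g'\in H$. For integers $m<i$, two $G$-sections $\Gamma_h,\Gamma_{h'}$ of the same level $i$ share a common $G$-section of level $m$ if there is a $G$-section $\Gamma_{h''}$ of level $m$ with $\Gamma_h\subseteq\Gamma_{h''}t^{i-m}$ and $\Gamma_{h'}\subseteq\Gamma_{h''}t^{i-m}$. *)

(* Defs.v *)
From HB Require Import structures.
From mathcomp Require Import all_boot all_order all_algebra generic_quotient.
From mathcomp Require Import boolp classical_sets.

Set Implicit Arguments.
Unset Strict Implicit.
Unset Printing Implicit Defensive.

Import Order.TTheory GRing.Theory Num.Theory.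

Local Open Scope classical_set_scope.
Local Open Scope quotient_scope.
Local Open Scope group_scope.

Section Groups.
Variable G : groupType.

Definition subgroup (H : set G) : Prop := group_closed (mem H).

Definition abelian_group : Prop := forall x y : G, commute x y.

Definition finitely_generated : Prop :=
  exists s : seq G, forall K : set G,
    subgroup K -> [set g | g \in s] `<=` K -> K = [set: G].

End Groups.

(* The group < S | u = v for R u v >.  The letter (s, false) stands for the
   generator s and (s, true) for its formal inverse. *)
Section Presentation.
Variables (S : choiceType) (R : seq (S * bool) -> seq (S * bool) -> Prop).

Notation word := (seq (S * bool)).

Definition winv (w : word) : word := rev [seq (l.1, ~~ l.2) | l <- w].

Inductive pcong : word -> word -> Prop :=
| PcongRel u v of R u v : pcong u v
| PcongVr s b : pcong [:: (s, b); (s, ~~ b)] [::]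
| PcongRefl u : pcong u u
| PcongSym u v of pcong u v : pcong v u
| PcongTrans u v w of pcong u v & pcong v w : pcong u w
| PcongCat u u' v v' of pcong u u' & pcong v v' : pcong (u ++ v) (u' ++ v').

Definition pcongb (u v : word) : bool := `[< pcong u v >].

Lemma pcongb_equiv : equiv_class_of pcongb.
Proof.
split; rewrite /pcongb.
- by move=> u; apply/asboolP/PcongRefl.
- by move=> u v; apply/asboolP/asboolP => /PcongSym.
- by move=> v u w /asboolP uv /asboolP vw; apply/asboolP/(PcongTrans uv).
Qed.

Canonical pcong_equiv := EquivRelPack pcongb_equiv.

Definition presented : Type := {eq_quot pcong_equiv}.
HB.instance Definition _ := Choice.on presented.

Definition pclass (w : word) : presented := \pi_({eq_quot pcong_equiv}) w.
Definition prepr (x : presented) : word := repr (x : {eq_quot pcong_equiv}).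

Lemma pclassP u v : pclass u = pclass v <-> pcong u v.
Proof.
by split=> [/eqmodP/asboolP|uv]; [|apply/eqmodP/asboolP].
Qed.

Lemma preprK : cancel prepr pclass. Proof. exact: reprK. Qed.

Lemma pcong_prepr w : pcong (prepr (pclass w)) w.
Proof. by apply/pclassP; rewrite preprK. Qed.

Lemma winvK : involutive winv.
Proof.
move=> w; rewrite /winv map_rev revK -map_comp -[RHS]map_id.
by apply: eq_map => -[s b] /=; rewrite negbK.
Qed.

Lemma pcong_winvr w : pcong (w ++ winv w) [::].
Proof.
elim: w => [|[s b] w IHw]; first exact: PcongRefl.
rewrite /winv /= rev_cons -cats1 -/(winv w) catA -cat1s.
apply: PcongTrans (PcongVr s b); rewrite -[X in pcong _ X]/([:: (s, b)] ++ _).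
apply: PcongCat (PcongRefl _) _; rewrite -[X in pcong _ X]cat0s.
exact: PcongCat IHw (PcongRefl _).
Qed.

Lemma pcong_winvl w : pcong (winv w ++ w) [::].
Proof. by have := pcong_winvr (winv w); rewrite winvK. Qed.

Lemma pcong_winv u v : pcong u v -> pcong (winv u) (winv v).
Proof.
move=> uv; have := PcongCat (PcongRefl (winv u)) (pcong_winvr v).
rewrite cats0 catA => /PcongSym/PcongTrans; apply.
rewrite -[X in pcong _ X]cat0s; apply: PcongCat (PcongRefl _).
apply: PcongTrans (pcong_winvl u).
by apply: PcongCat (PcongRefl _) _; exact: PcongSym.
Qed.

Definition pmul (x y : presented) := pclass (prepr x ++ prepr y).
Definition pinv (x : presented) := pclass (winv (prepr x)).

Lemma pclassM u v : pmul (pclass u) (pclass v) = pclass (u ++ v).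
Proof. by apply/pclassP/PcongCat; exact: pcong_prepr. Qed.

Lemma pclassV u : pinv (pclass u) = pclass (winv u).
Proof. exact/pclassP/pcong_winv/pcong_prepr. Qed.

Lemma pmulA : associative pmul.
Proof.
by move=> x y z; rewrite -(preprK x) -(preprK y) -(preprK z) !pclassM catA.
Qed.

Lemma pmul1 : left_id (pclass [::]) pmul.
Proof. by move=> x; rewrite -(preprK x) pclassM. Qed.

Lemma pmulr1 : right_id (pclass [::]) pmul.
Proof. by move=> x; rewrite -(preprK x) pclassM cats0. Qed.

Lemma pmulV : left_inverse (pclass [::]) pinv pmul.
Proof.
move=> x; rewrite -(preprK x) pclassV pclassM.
exact/pclassP/pcong_winvl.
Qed.

Lemma pmulrV : right_inverse (pclass [::]) pinv pmul.
Proof.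
move=> x; rewrite -(preprK x) pclassV pclassM.
exact/pclassP/pcong_winvr.
Qed.

HB.instance Definition _ :=
  isGroup.Build presented pmulA pmul1 pmulr1 pmulV pmulrV.

Definition pgen (s : S) : presented := pclass [:: (s, false)].

End Presentation.

(* G is presented by its multiplication table; the isomorphism type of the
   HNN-extension does not depend on the presentation of G.  The generator
   Some g is the element g of G and None is the stable letter t. *)
Section HNN.
Variables (G : groupType) (psi : {multiplicative G -> G}).

Inductive hnn_rel : seq (option G * bool) -> seq (option G * bool) -> Prop :=
| HnnMul g h :
    hnn_rel [:: (Some g, false); (Some h, false)] [:: (Some (g * h), false)]
| HnnConj g :
    hnn_rel [:: (None, false); (Some g, false); (None, true)]
            [:: (Some (psi g), false)].

Definition hnn : Type := presented hnn_rel.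
HB.instance Definition _ := Group.on hnn.

Definition emb (g : G) : hnn := pgen hnn_rel (Some g).
Definition stable : hnn := pgen hnn_rel None.

Lemma embM g h : emb (g * h) = emb g * emb h.
Proof.
rewrite [RHS]pclassM; apply/pclassP/PcongSym; exact/PcongRel/HnnMul.
Qed.

HB.instance Definition _ := isMultiplicative.Build G hnn emb embM.

Lemma hnn_conj g : stable * emb g * stable^-1 = emb (psi g).
Proof.
rewrite [X in _ * X]pclassV [X in X * _]pclassM [LHS]pclassM.
exact/pclassP/PcongRel/HnnConj.
Qed.

Local Notation t := stable.

Definition gsection (h : hnn) : set hnn := [set h * emb g | g in [set: G]].

Definition normal_form (h : hnn) (j : nat) (g : G) (i : nat) : Prop :=
  h = t ^- j * emb g * t ^+ i /\ (range psi g -> i = 0%N \/ j = 0%N).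

(* The G-section [Gam] has level [k]; normal forms being unique and the
   difference i - j constant on a G-section, there is only one such k. *)
Definition has_level (Gam : set hnn) (k : int) : Prop :=
  exists h j g i,
    [/\ Gam = gsection h, normal_form h j g i & k = (i%:Z - j%:Z)%R].

(* [Gam] and [Gam'] have the same level i > m and share a common G-section of
   level m. *)
Definition share_common_section (Gam Gam' : set hnn) (m : int) : Prop :=
  exists i : int,
    [/\ (m < i)%R, has_level Gam i, has_level Gam' i &
        exists h : hnn, let D := [set u * t ^+ `|i - m|%N | u in gsection h] in
          [/\ has_level (gsection h) m, Gam `<=` D & Gam' `<=` D]].

Definition section_periodic (A : Type) (x : hnn -> A) (H : set G) (h : hnn) :=
  forall g g', H g' -> x (h * emb g * emb g') = x (h * emb g).

End HNN.

Section Shift.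
Variables (K : groupType) (A : Type).

Definition shift (g : K) (x : K -> A) : K -> A := fun h => x (g^-1 * h).

Definition stab (x : K -> A) : set K := [set g | shift g x = x].

End Shift.

(* Main.v *)
Require Import Defs.
From HB Require Import structures.
From mathcomp Require Import all_boot all_order all_algebra.
From mathcomp Require Import boolp classical_sets.
From mathcomp Require Import zify.

(** Right translation inside a [G]-section of nonnegative level is left
translation by an element of [G].  Indeed [t g = psi(g) t] lets an element [b]
of [G] travel leftwards through [t ^- j * g * t ^+ i]: it becomes
[psi^i(b)] on crossing [t ^+ i], commutes with the middle factor because [G]
is abelian, and loses [j] applications of [psi] on crossing [t ^- j], which is
possible as [j <= i].  Hence [h b = psi^(i-j)(b) h] for every [h] of level
[i - j] ([emb_mul_level]).

If [b] lies in the [psi]-stable subgroup [H] and the level is at least [l],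
the left factor lies in [psi^l(H)], so it stabilizes [x]; therefore
[x (h b w) = x (h w)] for every [w] ([stab_level_invariant]).  Taking [w] in
[G] gives the periodicity of the section of [h], and taking [w] a power of
[t], with [H = G], shows that [x] is constant on the translate
[gsection h * t ^+ n], which contains both sections when they share [gsection h]. *)

Local Open Scope classical_set_scope.
Local Open Scope group_scope.

Set Implicit Arguments.
Unset Strict Implicit.

Section Levels.
Variables (G : groupType) (psi : {multiplicative G -> G}).

Local Notation t := (stable psi).
Local Notation emb := (emb psi).

Lemma stable_exp_emb n g : t ^+ n * emb g = emb (iter n psi g) * t ^+ n.
Proof.
elim: n => [|n IHn]; first by rewrite expg0 mul1g mulg1.
by rewrite expgS -mulgA IHn !mulgA iterS -hnn_conj mulgVK.
Qed.

Lemma stable_expN_emb n g : t ^- n * emb (iter n psi g) = emb g * t ^- n.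
Proof.
by rewrite -[LHS](mulgK (t ^+ n)) -(mulgA (t ^- n)) -stable_exp_emb mulKg.
Qed.

Lemma emb1 : emb 1 = 1.
Proof. by apply: (mulgI (emb 1)); rewrite -embM !mulg1. Qed.

Lemma mem_gsection (h : hnn psi) : gsection h h.
Proof. by exists 1 => //; rewrite emb1 mulg1. Qed.

(** The element [h] is an arbitrary member of a section of level [k], so it is
a normal form times an element [c] of [G]; commutativity also serves to move
[b] across [c]. *)
Lemma emb_mul_level (h : hnn psi) (k : nat) b : abelian_group G ->
  has_level (gsection h) k%:Z -> h * emb b = emb (iter k psi b) * h.
Proof.
move=> abG [h0 [j [g [i [h_h0 [h0E _] kE]]]]].
have iE : i = (j + k)%N by lia.
have := mem_gsection h; rewrite h_h0 => -[c _ <-].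
have embC u v : emb u * emb v = emb v * emb u by rewrite -!embM abG.
rewrite -mulgA embC !mulgA h0E; congr (_ * _).
rewrite -[LHS]mulgA stable_exp_emb !mulgA; congr (_ * _).
by rewrite -[LHS]mulgA embC mulgA iE iterD stable_expN_emb.
Qed.

Lemma iter_psi_stable (H : set G) n b : psi @` H `<=` H -> H b ->
  H (iter n psi b).
Proof.
by move=> psiH Hb; elim: n => //= n IHn; apply: psiH; exists (iter n psi b).
Qed.

Lemma stab_mull (K : groupType) (A : Type) (x : K -> A) s y :
  stab x s -> x (s * y) = x y.
Proof. by move=> xs; rewrite -{1}xs /shift mulKg. Qed.

(** The free factor [w] is what makes this serve both for periodicity, with
[w] in [G], and for sections of higher level, with [w] a power of [t]. *)
Lemma stab_level_invariant (A : Type) (x : hnn psi -> A) (H : set G) (l : nat)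
    (h : hnn psi) (k : int) b w :
  abelian_group G -> psi @` H `<=` H -> emb @` (iter l psi @` H) `<=` stab x ->
  has_level (gsection h) k -> (l%:Z <= k)%R -> H b ->
  x (h * emb b * w) = x (h * w).
Proof.
move=> abG psiH stabx; case: k => // k hk lk Hb.
have {}lk : (l <= k)%N by [].
rewrite (emb_mul_level b abG hk) -mulgA; apply/stab_mull/stabx.
exists (iter k psi b) => //; exists (iter (k - l) psi b).
  exact: iter_psi_stable.
by rewrite -iterD subnKC.
Qed.

End Levels.

Theorem proposition3p1
  (G : groupType) (hfg : finitely_generated G) (hab : abelian_group G)
  (psi : {multiplicative G -> G})
  (psi_inj : injective psi) (psi_nsurj : range psi <> [set: G])
  (A : finType) (x : hnn psi -> A)
  (H : set G) (hH : subgroup H) (psiH : psi @` H `<=` H)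
  (l : nat) (hstab : emb psi @` (iter l psi @` H) `<=` stab x) :
  (forall (h : hnn psi) (k : int),
     has_level (gsection h) k -> (l%:Z <= k)%R -> section_periodic x H h) /\
  (H = [set: G] ->
   forall (h h' : hnn psi) (m : int),
     (l%:Z <= m)%R -> share_common_section (gsection h) (gsection h') m ->
     forall u v, (gsection h `|` gsection h') u ->
                 (gsection h `|` gsection h') v -> x u = x v).
Proof.
split=> [h k hk lk g g' Hg'|HG h h' m lm].
  rewrite -mulgA -embM hab embM mulgA.
  exact: stab_level_invariant hk lk Hg'.
move=> [i [_ _ _ [h0 [h0m hD h'D]]]].
have xD u : (gsection h `|` gsection h') u ->
    x u = x (h0 * stable psi ^+ `|i - m|%N).
  have uD : (gsection h `|` gsection h') u ->
      [set w * stable psi ^+ `|i - m|%N | w in gsection h0] u.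
    by case=> [/hD|/h'D].
  move=> /uD [_ [b _ <-] <-].
  by apply: (stab_level_invariant _ hab psiH hstab h0m lm); rewrite HG.
by move=> u v /xD-> /xD->.
Qed.
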